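(* Let $d>1$. The map $Z:\Pi_n^d\to\Pi_n^{(d)}\subseteq\Pi_{n,1}$ given by zeroing each block, $$Z:\ B_0/B_1/\cdots/B_\ell\ \mapsto\ B_0/B_1^{\mathrm{zero}}/\cdots/B_\ell^{\mathrm{zero}},$$ is a rank-preserving surjective $\mathfrak S_n$-poset map (i.e. an order-preserving, $\mathfrak S_n$-equivariant, surjective map that preserves rank).
   Context: For $m\ge1$, an $m$-weighted partition of $\{0,1,\ldots,n\}$ is a set partition $B_0/B_1/\cdots/B_\ell$ of $\{0,1,\ldots,n\}$ with $0\in B_0$ (the zero block), together with a weight in $\mathbb Z/m\mathbb Z$ assigned to each element of $B_1\cup\cdots\cup B_\ell$; elements of $B_0$ are unweighted. For a nonzero block $B$ and $w\in\mathbb Z/m\mathbb Z$, $B^w$ is obtained by adding $w$ to the weight of each element, $B^{\mathrm{erase}}$ is obtained by removing all weights (with $B_0^{\mathrm{erase}}=B_0$), and $B^{\mathrm{zero}}$ is obtained by replacing each weight with $0$. Weighted partitions are identified if they differ by replacing nonzero blocks $B$ by shifts $B^w$. $\Pi_{n,m}$ is the set of $m$-weighted partitions (up to this identification), with $\pi_1\le\pi_2$ if for each block $B$ of $\pi_1$ there is a block of $\pi_2$ that either contains $B^{\mathrm{erase}}$ or contains $B^w$ for some $w$. $\mathfrak S_n$ acts by $\sigma(B_0/\cdots/B_\ell)=\sigma B_0/\cdots/\sigma B_\ell$ (fixing $0$, elements carrying their weights). In particular $\Pi_{n,1}$ is the lattice of set partitions of $\{0,1,\ldots,n\}$ ordered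 by refinement (all weights being $0$). $\Pi_n^d\subseteq\Pi_{n,d}$ is the subposet of balanced partitions: those for which, in each block, all weights $w\in\mathbb Z/d\mathbb Z$ appear with equal multiplicity (vacuous for the zero block). The type of $x=B_0/B_1/\cdots/B_\ell$ is $(|B_0\setminus\{0\}|,\{|B_1|,\ldots,|B_\ell|\})$, the second entry being a multiset. With $a(d)=\lfloor n/d\rfloor$, the pointed $d$-divisible partition poset $\Pi_n^{(d)}$ is the upper order ideal of $\Pi_{n,1}$ generated by the elements of type $(n-d\cdot a(d),\{d,d,\ldots,d\})$ ($a(d)$ copies of $d$), with the induced $\mathfrak S_n$-action. Ranks in these graded posets are normalized so that minimal elements have rank $0$. *)

(* Defs.v *)
From HB Require Import structures.
From mathcomp Require Import all_boot all_order all_algebra all_fingroup.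
From mathcomp Require Import generic_quotient.

Set Implicit Arguments.
Unset Strict Implicit.
Unset Printing Implicit Defensive.

Import Order.TTheory GRing.Theory.

Local Open Scope quotient_scope.

(* Z/mZ for m >= 1.  'Z_m is avoided because 'Z_1 has two elements; only the
   additive structure is needed, and 'I_k.+1 carries it for every k. *)
Notation Zmod m := 'I_m.-1.+1.

(* (i, Some w) is the element i with weight w, (i, None) is i unweighted. *)
Notation welt n m := ('I_n.+1 * option (Zmod m))%type.
Notation wblock n m := {set welt n m}.

Section WeightedPartitions.
Variables n m : nat.

Definition elt0 : welt n m := (ord0, None).

Definition is_wpart (P : {set wblock n m}) : bool :=
  [&& trivIset P, set0 \notin P,
      [forall i : 'I_n.+1, #|[set a | (i, a) \in cover P]| == 1],
      elt0 \in cover P &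
      [forall B in P, forall p in B, (p.2 == None) == (elt0 \in B)]].

Record wpart := WPart { wblocks :> {set wblock n m}; _ : is_wpart wblocks }.

HB.instance Definition _ := [isSub for wblocks].
HB.instance Definition _ := [Finite of wpart by <:].

Definition zero_block (P : wpart) : wblock n m := pblock P elt0.

(* The paper's B^w; on a zero block it is the identity. *)
Definition shift (w : Zmod m) (B : wblock n m) : wblock n m :=
  [set (p.1, omap (fun u => u + w)%R p.2) | p in B].

Definition erase (B : wblock n m) : wblock n m := [set (p.1, None) | p in B].

Definition wequiv (P Q : wpart) : bool :=
  [exists f : {ffun wblock n m -> Zmod m},
     wblocks Q == [set shift (f B) B | B in wblocks P]].

Definition wle (P Q : wpart) : bool :=
  [forall B in wblocks P, exists C in wblocks Q,
     (erase B \subset C) || [exists w, shift w B \subset C]].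

(* The multiset of block sizes is represented by its nonincreasing sort. *)
Definition wtype (P : wpart) : nat * seq nat :=
  (#|zero_block P :\ elt0|,
   sort geq [seq #|B| | B : wblock n m in wblocks P :\ zero_block P]).

Definition wbalanced (P : wpart) : bool :=
  [forall B in wblocks P, forall w : Zmod m, forall w' : Zmod m,
     #|[set p in B | p.2 == Some w]| == #|[set p in B | p.2 == Some w']|].

Lemma wpartP (P : {set wblock n m}) :
  reflect
    [/\ forall B, B \in P -> B != set0,
        forall i, exists B, exists2 a, B \in P & (i, a) \in B,
        forall B C i a b, B \in P -> C \in P -> (i, a) \in B -> (i, b) \in C ->
          B = C /\ a = b,
        exists2 B, B \in P & elt0 \in B
      & forall B p, B \in P -> p \in B -> (p.2 == None) = (elt0 \in B)]
    (is_wpart P).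
Proof.
apply: (iffP and5P) => [[tP P0 cP zP kP]|[P0 cP uP [B0 B0P zB0] kP]].
- split.
  + by move=> B BP; apply: contraNneq P0 => <-.
  + move=> i; move/forallP/(_ i)/cards1P: cP => [a Ea].
    have: a \in [set a | (i, a) \in cover P] by rewrite Ea inE.
    by rewrite inE => /bigcupP[B BP iB]; exists B, a.
  + move=> B C i a b BP CP iB iC.
    have ab : a = b.
      move/forallP/(_ i)/cards1P: cP => [c Ec].
      have Ha : a \in [set a | (i, a) \in cover P].
        by rewrite inE; apply/bigcupP; exists B.
      have Hb : b \in [set a | (i, a) \in cover P].
        by rewrite inE; apply/bigcupP; exists C.
      by move: Ha Hb; rewrite Ec !inE => /eqP-> /eqP->.
    split=> //; rewrite -ab in iC.
    by rewrite -(def_pblock tP BP iB) (def_pblock tP CP iC).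
  + by case/bigcupP: zP => B; exists B.
  + by move=> B p BP pB; move/forall_inP/(_ B BP)/forall_inP/(_ p pB)/eqP: kP.
- split.
  + apply/trivIsetP => B C BP CP; apply: contraNT => /pred0Pn[[i a]] /andP[iB iC].
    by apply/eqP; have [] := uP _ _ _ _ _ BP CP iB iC.
  + by apply/negP => /P0; rewrite eqxx.
  + apply/forallP => i; have [B [a BP iB]] := cP i.
    apply/cards1P; exists a; apply/setP => b; rewrite !inE.
    apply/bigcupP/eqP => [[C CP iC]|->]; last by exists B.
    by have [_ ->] := uP _ _ _ _ _ BP CP iB iC.
  + by apply/bigcupP; exists B0.
  + apply/forall_inP => B BP; apply/forall_inP => p pB.
    by rewrite (kP B p BP pB).
Qed.

Lemma zero_blockP (P : wpart) B : B \in wblocks P ->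
  (B == zero_block P) = (elt0 \in B).
Proof.
case: P => P wP /= BP; rewrite /zero_block /=.
have/and5P[tP _ _ zP _] := wP.
apply/eqP/idP => [->|zB]; first by rewrite mem_pblock.
by rewrite (def_pblock tP BP zB).
Qed.

Lemma zero_block_in (P : wpart) : zero_block P \in wblocks P.
Proof.
by case: P => P wP; rewrite /zero_block /= pblock_mem //; case/and5P: wP.
Qed.

Lemma shift_mem w (B : wblock n m) (p : welt n m) : p \in B ->
  (p.1, omap (fun u => u + w)%R p.2) \in shift w B.
Proof. by move=> pB; apply/imsetP; exists p. Qed.

Lemma shiftD w w' B : shift w (shift w' B) = shift (w' + w)%R B.
Proof.
rewrite /shift -imset_comp; apply: eq_imset => -[i [u|]] //=.
by rewrite addrA.
Qed.

Lemma shift0 B : shift 0%R B = B.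
Proof.
by rewrite /shift -[RHS]imset_id; apply: eq_imset => -[i [u|]] //=; rewrite addr0.
Qed.

Lemma shiftK w : cancel (shift w) (shift (- w)%R).
Proof. by move=> B; rewrite shiftD addrN shift0. Qed.

Lemma shift_inj w : injective (shift w).
Proof. exact: can_inj (shiftK w). Qed.

Lemma card_shift w (B : wblock n m) : #|shift w B| = #|B|.
Proof.
pose g (p : welt n m) := (p.1, omap (fun u => u - w)%R p.2).
apply: card_imset; apply: (can_inj (g := g)) => -[i [u|]] //.
by rewrite /g /= addrK.
Qed.

Lemma elt0_shift w (B : wblock n m) : (elt0 \in shift w B) = (elt0 \in B).
Proof.
apply/imsetP/idP => [[[i [u|]] iB //= [i0]]|zB]; last by exists elt0.
by rewrite /elt0 i0.
Qed.

Lemma wleP (P Q : wpart) :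
  reflect (forall B, B \in wblocks P -> exists2 C, C \in wblocks Q &
             erase B \subset C \/ exists w, shift w B \subset C)
          (wle P Q).
Proof.
apply: (iffP forall_inP) => H B BP.
- have /exists_inP[C CQ /orP h] := H B BP; exists C => //.
  by case: h => [|/existsP[w ?]]; [left|right; exists w].
- have [C CQ h] := H B BP; apply/exists_inP; exists C => //; apply/orP.
  by case: h => [|[w ?]]; [left|right; apply/existsP; exists w].
Qed.

Lemma wle_refl : reflexive wle.
Proof.
by move=> P; apply/wleP => B BP; exists B => //; right; exists 0%R; rewrite shift0.
Qed.

Lemma eraseS (B C : wblock n m) : B \subset C -> erase B \subset erase C.
Proof. exact: imsetS. Qed.

Lemma erase_shift w (B : wblock n m) : erase (shift w B) = erase B.
Proof. by rewrite /erase /shift -imset_comp; apply: eq_imset => -[]. Qed.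

Lemma eraseK (B : wblock n m) : erase (erase B) = erase B.
Proof. by rewrite /erase -imset_comp; apply: eq_imset => -[]. Qed.

Lemma shift_erase w (B : wblock n m) : shift w (erase B) = erase B.
Proof. by rewrite /erase /shift -imset_comp; apply: eq_imset => -[]. Qed.

Lemma wle_trans : transitive wle.
Proof.
move=> Q P R /wleP PQ /wleP QR; apply/wleP => B /PQ[C /QR[D DR CD] BC].
exists D => //.
case: BC CD => [eBC|[w sBC]] [eCD|[w' sCD]].
- by left; rewrite -eraseK; apply: subset_trans eCD; apply: eraseS.
- by left; rewrite -(shift_erase w'); apply: subset_trans sCD; apply: imsetS.
- by left; rewrite -(erase_shift w); apply: subset_trans eCD; apply: eraseS.
- by right; exists (w + w')%R; rewrite -shiftD; apply: subset_trans sCD; apply: imsetS.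
Qed.

Lemma wequiv_wle (P Q : wpart) : wequiv P Q -> wle P Q && wle Q P.
Proof.
case/existsP=> f /eqP EQ; apply/andP; split; apply/wleP => B.
- move=> BP; exists (shift (f B) B); first by rewrite EQ; apply: imset_f.
  by right; exists (f B).
- rewrite EQ => /imsetP[C CP ->]; exists C => //.
  by right; exists (- f C)%R; rewrite shiftK.
Qed.

Lemma wle_antisym (P Q : wpart) : wle P Q -> wle Q P -> wequiv P Q.
Proof.
case: P Q => [P wP] [Q wQ] /wleP /= PQ /wleP /= QP.
have [P0 cP uP zP kP] := wpartP P wP.
have [Q0 cQ uQ zQ kQ] := wpartP Q wQ.
have key B : B \in P -> exists w, shift w B \in Q.
  move=> BP; have [C CQ BC] := PQ B BP; have [D DP CD] := QP C CQ.
  have fstBC i a : (i, a) \in B -> exists b, (i, b) \in C.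
    move=> iB; case: BC => [/subsetP s|[w /subsetP s]].
    + by exists None; apply: s; apply/imsetP; exists (i, a).
    + by exists (omap (fun u => u + w)%R a); apply/s/(shift_mem w iB).
  have fstCD i a : (i, a) \in C -> exists b, (i, b) \in D.
    move=> iC; case: CD => [/subsetP s|[w /subsetP s]].
    + by exists None; apply: s; apply/imsetP; exists (i, a).
    + by exists (omap (fun u => u + w)%R a); apply/s/(shift_mem w iC).
  have /set0Pn[[i a] iB] := P0 B BP.
  have [b iC] := fstBC i a iB; have [c iD] := fstCD i b iC.
  have [BD _] := uP _ _ _ _ _ BP DP iB iD; rewrite -BD in fstCD.
  have [w sBC] : exists w, shift w B \subset C.
    case: BC => // /subsetP s; exists 0%R; rewrite shift0.
    have zC : elt0 \in C.
      rewrite -(kQ C (i, None)) //; apply: s; apply/imsetP; by exists (i, a).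
    have zB : elt0 \in B.
      have [e zeB] := fstCD _ _ zC; have [Z ZP zZ] := zP.
      by have [-> _] := uP _ _ _ _ _ BP ZP zeB zZ.
    apply/subsetP => -[j u] jB; apply: s; apply/imsetP; exists (j, u) => //=.
    by have := kP B (j, u) BP jB; rewrite zB => /eqP/= ->.
  exists w; suff -> : shift w B = C by [].
  apply/eqP; rewrite eqEsubset sBC; apply/subsetP => -[j u] jC.
  have [v jB] := fstCD _ _ jC.
  have js := shift_mem w jB; have js' := subsetP sBC _ js.
  by have [_ ->] := uQ _ _ _ _ _ CQ CQ jC js'.
pose f0 (B : wblock n m) : Zmod m := odflt 0%R [pick w | shift w B \in Q].
pose f : {ffun wblock n m -> Zmod m} := [ffun B => f0 B].
have fP B : B \in P -> shift (f B) B \in Q.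
  move=> BP; rewrite ffunE /f0; case: pickP => //= no.
  by have [w sQ] := key B BP; have := no w; rewrite sQ.
apply/existsP; exists f; apply/eqP/setP => C /=.
apply/idP/imsetP => [CQ|[B BP ->]]; last exact: fP.
have /set0Pn[[i a] iC] := Q0 C CQ.
have [B [b BP iB]] := cP i; exists B => //.
by have [] := uQ _ _ _ _ _ CQ (fP B BP) iC (shift_mem (f B) iB).
Qed.

Lemma wequivE (P Q : wpart) : wequiv P Q = wle P Q && wle Q P.
Proof.
apply/idP/idP; first exact: wequiv_wle.
by case/andP; apply: wle_antisym.
Qed.

Lemma wequiv_refl : reflexive wequiv.
Proof. by move=> P; rewrite wequivE wle_refl. Qed.

Lemma wequiv_sym : symmetric wequiv.
Proof. by move=> P Q; rewrite !wequivE andbC. Qed.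

Lemma wequiv_trans : transitive wequiv.
Proof.
move=> Q P R; rewrite !wequivE => /andP[PQ QP] /andP[QR RQ].
by rewrite (wle_trans PQ QR) (wle_trans RQ QP).
Qed.

Canonical wequiv_equiv := EquivRel wequiv wequiv_refl wequiv_sym wequiv_trans.

Lemma wtype_image (F : wblock n m -> wblock n m) (P Q : wpart) :
  {in wblocks P &, injective F} -> (forall B, #|F B| = #|B|) ->
  (forall B, (elt0 \in F B) = (elt0 \in B)) ->
  wblocks Q = [set F B | B in wblocks P] -> wtype P = wtype Q.
Proof.
move=> injF cardF zF EQ.
have F0 : F (zero_block P) = zero_block Q.
  apply/eqP; rewrite zero_blockP; last by rewrite EQ; apply/imset_f/zero_block_in.
  by rewrite zF -(zero_blockP (zero_block_in P)).
have EQ0 : wblocks Q :\ zero_block Q = [set F B | B in wblocks P :\ zero_block P].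
  apply/setP => C; rewrite inE in_set1 EQ; apply/andP/imsetP.
  - case=> CnZ /imsetP[B BP EC]; exists B => //; rewrite !inE BP andbT.
    by apply: contraNneq CnZ => EB; rewrite EC EB F0.
  - case=> B; rewrite !inE => /andP[BnZ BP] ->; split; last exact: imset_f.
    rewrite -F0; apply: contraNneq BnZ => /injF -> //; exact: zero_block_in.
congr (_, _).
- have z (R : wpart) : elt0 \in zero_block R.
    by rewrite -(zero_blockP (zero_block_in R)).
  have := cardsD1 elt0 (zero_block P); have := cardsD1 elt0 (zero_block Q).
  by rewrite !z -{1}F0 cardF => -> /eqP; rewrite eqn_add2l eq_sym => /eqP.
- apply/perm_sortP.
  + by move=> x y; apply: leq_total.
  + by move=> x y z yx xz; apply: leq_trans xz yx.
  + by move=> x y; rewrite andbC; apply: anti_leq.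
  rewrite EQ0; set A := (_ :\ _).
  have pm : perm_eq (enum [set F B | B in A]) [seq F B | B <- enum A].
    apply: uniq_perm; first exact: enum_uniq.
    - rewrite map_inj_in_uniq ?enum_uniq // => B C.
      by rewrite !mem_enum !inE => /andP[_ BP] /andP[_ CP]; apply: injF.
    - move=> C; rewrite mem_enum; apply/imsetP/mapP => -[B BA ->]; exists B => //.
      + by rewrite mem_enum.
      + by rewrite mem_enum in BA.
  rewrite perm_sym; apply: perm_trans (perm_map _ pm) _.
  by rewrite -map_comp (eq_map (g := fun B : wblock n m => #|B|)).
Qed.

Lemma wtype_wequiv (P Q : wpart) : wequiv P Q -> wtype P = wtype Q.
Proof.
case/existsP=> f /eqP EQ; pose F B := shift (f B) B.
apply: (@wtype_image F) EQ => [B C BP CP EF|B|B]; last exact: elt0_shift.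
- have [P0 _ uP _ _] := wpartP _ (valP P).
  have /set0Pn[[i a] iB] := P0 B BP.
  have := shift_mem (f B) iB; rewrite -/(F B) EF => /imsetP[[j b] jC [/= ij _]].
  by rewrite -ij in jC; have [] := uP _ _ _ _ _ BP CP iB jC.
- exact: card_shift.
Qed.

End WeightedPartitions.

Lemma is_wpart_image n m m' (g : 'I_n.+1 -> 'I_n.+1)
    (h : option (Zmod m) -> option (Zmod m')) (P : wpart n m) :
  bijective g -> g ord0 = ord0 -> (forall a, (h a == None) = (a == None)) ->
  is_wpart [set [set (g p.1, h p.2) | p in B] | B : wblock n m in wblocks P].
Proof.
move=> [g' gK g'K] g0 hN; have [P0 cP uP [B0 B0P zB0] kP] := wpartP _ (valP P).
pose F (B : wblock n m) := [set (g p.1, h p.2) | p in B].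
have hNone : h None = None by apply/eqP; rewrite hN.
have F0 B : B \in wblocks P -> (elt0 _ _ \in F B) = (elt0 _ _ \in B).
  move=> BP; apply/imsetP/idP => [[[i a] iB [/= i0 a0]]|zB]; last first.
    by exists (elt0 n m); rewrite //= g0 hNone.
  have -> : elt0 n m = (i, a); last by [].
  have /eqP -> : a == None by rewrite -hN -a0.
  by congr (_, _); apply: (can_inj gK); rewrite g0.
apply/wpartP; split.
- move=> _ /imsetP[B BP ->]; have /set0Pn[p pB] := P0 B BP.
  by apply/set0Pn; exists (g p.1, h p.2); apply/imsetP; exists p.
- move=> i; have [B [a BP iB]] := cP (g' i); exists (F B), (h a); first exact: imset_f.
  by apply/imsetP; exists (g' i, a); rewrite //= g'K.
- move=> _ _ i a b /imsetP[B BP ->] /imsetP[C CP ->].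
  move=> /imsetP[[j u] jB [/= -> ->]] /imsetP[[k v] kC [/= /(can_inj gK) jk ->]].
  by rewrite -jk in kC; have [-> ->] := uP _ _ _ _ _ BP CP jB kC.
- by exists (F B0); [apply: imset_f | rewrite F0].
- move=> _ p /imsetP[B BP ->] /imsetP[[j u] jB ->] /=.
  by rewrite hN (kP B _ BP jB) F0.
Qed.

Section ActionAndZero.
Variables n m : nat.

(* The 'S_n-action permutes 1, ..., n and fixes 0: lift_perm ord0 ord0 s sends
   ord0 to itself and lift ord0 i, i.e. i.+1, to lift ord0 (s i). *)
Definition perm_block (s : 'S_n) (B : wblock n m) : wblock n m :=
  [set (lift_perm ord0 ord0 s p.1, p.2) | p in B].

Lemma wact_subproof (s : 'S_n) (P : wpart n m) :
  is_wpart [set perm_block s B | B : wblock n m in wblocks P].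
Proof.
apply: (@is_wpart_image n m m (lift_perm ord0 ord0 s) id) => //.
- by exists (lift_perm ord0 ord0 s)^-1%g; [apply: permK | apply: permKV].
- exact: lift_perm_id.
Qed.

Definition wact (s : 'S_n) (P : wpart n m) : wpart n m := WPart (wact_subproof s P).

Definition zero (B : wblock n m) : wblock n 1 :=
  [set (p.1, omap (fun=> 0%R : Zmod 1) p.2) | p in B].

Lemma wzero_subproof (P : wpart n m) :
  is_wpart [set zero B | B : wblock n m in wblocks P].
Proof.
apply: (@is_wpart_image n m 1 id (omap (fun=> 0%R : Zmod 1))) => //.
- by exists id.
- by case.
Qed.

Definition wzero (P : wpart n m) : wpart n 1 := WPart (wzero_subproof P).

Lemma wle_wact (s : 'S_n) (P Q : wpart n m) : wle P Q -> wle (wact s P) (wact s Q).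
Proof.
move=> /wleP PQ; apply/wleP => _ /imsetP[B /PQ[C CQ h] ->].
exists (perm_block s C); first exact: imset_f.
case: h => [/(imsetS (fun p => (lift_perm ord0 ord0 s p.1, p.2))) h|[w h]].
- left; apply: subset_trans h.
  by rewrite /erase /perm_block -!imset_comp; apply: subxx.
- right; exists w; apply: subset_trans (imsetS _ h).
  by rewrite /shift /perm_block -!imset_comp; apply: subxx.
Qed.

Lemma wact_wequiv (s : 'S_n) (P Q : wpart n m) :
  wequiv P Q -> wequiv (wact s P) (wact s Q).
Proof. by rewrite !wequivE => /andP[/(wle_wact s) -> /(wle_wact s) ->]. Qed.

Lemma perm_block1 : perm_block 1 =1 id.
Proof.
move=> B; rewrite /perm_block lift_perm1 -[RHS]imset_id.
by apply: eq_imset => -[i a] /=; rewrite perm1.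
Qed.

Lemma perm_blockM (s t : 'S_n) : perm_block (s * t) =1 perm_block t \o perm_block s.
Proof.
move=> B; rewrite /perm_block /= -imset_comp; apply: eq_imset => -[i a] /=.
by rewrite -(lift_permM _ ord0) permM.
Qed.

Lemma perm_block_inj (s : 'S_n) : injective (perm_block s).
Proof.
apply: (can_inj (g := perm_block s^-1)) => B.
by rewrite -[LHS]/((_ \o _) B) -perm_blockM mulgV perm_block1.
Qed.

Lemma wact1 (P : wpart n m) : wact 1 P = P.
Proof. by apply: val_inj; rewrite /= (eq_imset _ perm_block1) imset_id. Qed.

Lemma wactM (s t : 'S_n) (P : wpart n m) : wact (s * t) P = wact t (wact s P).
Proof. by apply: val_inj; rewrite /= (eq_imset _ (perm_blockM s t)) imset_comp. Qed.

Lemma wtype_wact (s : 'S_n) (P : wpart n m) : wtype (wact s P) = wtype P.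
Proof.
apply/esym/(@wtype_image _ _ (perm_block s)) => //.
- by move=> B C _ _ /perm_block_inj.
- by move=> B; apply: card_imset => -[i a] [j b] /= [/perm_inj-> ->].
- move=> B; apply/imsetP/idP => [[[i a] iB [/= i0 a0]]|zB].
  + suff -> : elt0 n m = (i, a) by [].
    rewrite -a0; congr (_, _); apply: (@perm_inj _ (lift_perm ord0 ord0 s)).
    by rewrite lift_perm_id.
  + by exists (elt0 n m); rewrite //= lift_perm_id.
Qed.

Lemma wbalanced_wact (s : 'S_n) (P : wpart n m) : wbalanced P -> wbalanced (wact s P).
Proof.
move/forall_inP => bP; apply/forall_inP => _ /imsetP[B BP ->].
have cnt w : #|[set p in perm_block s B | p.2 == Some w]|
           = #|[set p in B | p.2 == Some w]|.
  pose g (p : welt n m) := (lift_perm ord0 ord0 s p.1, p.2).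
  have gI : injective g by move=> [i a] [j b] /= [/perm_inj-> ->].
  rewrite -[RHS](card_imset _ gI); apply: eq_card => -[i a]; rewrite inE.
  apply/andP/imsetP => [[/imsetP[p pB ->] /= pw]|[p]].
  - by exists p; rewrite // inE pB.
  - by rewrite inE => /andP[pB pw] ->; split; first by apply/imsetP; exists p.
apply/forallP => w; apply/forallP => w'; rewrite !cnt.
by have /forallP/(_ w)/forallP/(_ w') := bP B BP.
Qed.

Lemma wzero_wequiv (P Q : wpart n m) : wequiv P Q -> wequiv (wzero P) (wzero Q).
Proof.
case/existsP=> f /eqP EQ; suff -> : wzero P = wzero Q by apply: wequiv_refl.
apply: val_inj => /=; rewrite EQ -imset_comp; apply: eq_imset => B /=.
by rewrite /zero /shift -imset_comp; apply: eq_imset => -[i [u|]].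
Qed.

Lemma wbalanced_wequiv (P Q : wpart n m) : wequiv P Q -> wbalanced P = wbalanced Q.
Proof.
suff bal : forall P' Q' : wpart n m, wequiv P' Q' -> wbalanced P' -> wbalanced Q'.
  by move=> PQ; apply/idP/idP; apply: bal; rewrite // wequiv_sym.
move=> P' Q'.
case/existsP=> f /eqP EQ /forall_inP bP; apply/forall_inP => C; rewrite EQ.
case/imsetP=> B BP ->.
have cnt w : #|[set p in shift (f B) B | p.2 == Some w]|
           = #|[set p in B | p.2 == Some (w - f B)%R]|.
  rewrite -[RHS](card_shift (f B)); apply: eq_card => -[i a]; rewrite inE.
  apply/andP/imsetP => [[/imsetP[[j [u|]] jB [/= -> ->]] //= /eqP[<-]]|].
  - by exists (j, Some u); rewrite // inE jB addrK /=.
  - case=> -[j [u|]]; rewrite inE => /andP[jB /eqP] //= [uE] [-> ->].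
    split; first by apply/imsetP; exists (j, Some u).
    by rewrite /= uE subrK.
apply/forallP => w; apply/forallP => w'; rewrite !cnt.
by have /forallP/(_ (w - f B)%R)/forallP/(_ (w' - f B)%R) := bP B BP.
Qed.

End ActionAndZero.

(* Pi_{n,m}, for m >= 1. *)
Definition Pi n m := {eq_quot (@wequiv n m)}.

HB.instance Definition _ n m := Choice.on (Pi n m).
HB.instance Definition _ n m := EqQuotient.on (Pi n m).
HB.instance Definition _ n m := @CanIsCountable (wpart n m) (Pi n m) _ _ reprK.
HB.instance Definition _ n m := isFinite.Build (Pi n m)
  (pcan_enumP (can_pcan (@reprK (wpart n m) (Pi n m)))).

Definition pclass n m (P : wpart n m) : Pi n m := \pi_(Pi n m) P.

Lemma reprPi n m (x : Pi n m) : pclass (repr x) = x.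
Proof. exact: reprK. Qed.

Lemma eqPi n m (P Q : wpart n m) : (pclass P == pclass Q) = wequiv P Q.
Proof. by rewrite /pclass piE. Qed.

Lemma wequiv_repr n m (P : wpart n m) : wequiv (repr (pclass P)) P.
Proof. by rewrite -eqPi reprPi. Qed.

Section PiOps.
Variables n m : nat.
Implicit Types (P : wpart n m) (x y : Pi n m).

Definition Pi_le x y : bool := wle (repr x) (repr y).

Lemma Pi_le_refl : reflexive Pi_le.
Proof. by move=> x; apply: wle_refl. Qed.

Lemma Pi_le_anti : antisymmetric Pi_le.
Proof.
by move=> x y /andP[xy yx]; apply/eqP; rewrite -[x]reprPi -[y]reprPi eqPi wle_antisym.
Qed.

Lemma Pi_le_trans : transitive Pi_le.
Proof. by move=> y x z; apply: wle_trans. Qed.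

Definition Pi_act (s : 'S_n) x : Pi n m := pclass (wact s (repr x)).

(* The paper's Z, defined on the whole of Pi_{n,m}. *)
Definition Z x : Pi n 1 := pclass (wzero (repr x)).

Definition Pi_type x : nat * seq nat := wtype (repr x).

Definition balanced x : bool := wbalanced (repr x).

Lemma Pi_actE s P : Pi_act s (pclass P) = pclass (wact s P).
Proof. by apply/eqP; rewrite eqPi; apply/wact_wequiv/wequiv_repr. Qed.

Lemma ZE P : Z (pclass P) = pclass (wzero P).
Proof. by apply/eqP; rewrite eqPi; apply/wzero_wequiv/wequiv_repr. Qed.

Lemma Pi_typeE P : Pi_type (pclass P) = wtype P.
Proof. exact/wtype_wequiv/wequiv_repr. Qed.

Lemma balancedE P : balanced (pclass P) = wbalanced P.
Proof. exact/wbalanced_wequiv/wequiv_repr. Qed.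

End PiOps.

Fact Pi_display : Order.disp_t. Proof. exact: Order.Disp tt tt. Qed.

HB.instance Definition _ n m := Order.Le_isPOrder.Build Pi_display (Pi n m)
  (@Pi_le_refl n m) (@Pi_le_anti n m) (@Pi_le_trans n m).

Lemma Pi_leE n m (P Q : wpart n m) :
  (pclass P <= pclass Q)%O = wle P Q.
Proof.
have /andP[P1 P2] : wle (repr (pclass P)) P && wle P (repr (pclass P)).
  by rewrite -wequivE wequiv_repr.
have /andP[Q1 Q2] : wle (repr (pclass Q)) Q && wle Q (repr (pclass Q)).
  by rewrite -wequivE wequiv_repr.
apply/idP/idP => h.
- exact: wle_trans (wle_trans P2 h) Q1.
- exact: wle_trans (wle_trans P1 h) Q2.
Qed.

(* In mathcomp (s * t) i = t (s i), hence the order of composition. *)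
Lemma Pi_act_action n m :
  (forall x : Pi n m, Pi_act 1 x = x) /\
  (forall s t (x : Pi n m), Pi_act (s * t) x = Pi_act t (Pi_act s x)).
Proof.
split=> [x|s t x]; rewrite -[x]reprPi.
- by rewrite Pi_actE wact1.
- by rewrite !Pi_actE wactM.
Qed.

Lemma Pi_le_act n m s (x y : Pi n m) : (x <= y)%O -> (Pi_act s x <= Pi_act s y)%O.
Proof. by rewrite -[x]reprPi -[y]reprPi !Pi_actE !Pi_leE; apply: wle_wact. Qed.

Lemma balanced_act n m s (x : Pi n m) : balanced x -> balanced (Pi_act s x).
Proof. by rewrite -[x]reprPi Pi_actE !balancedE; apply: wbalanced_wact. Qed.

(* Membership in the pointed d-divisible partition poset. *)
Definition pointed_divisible n d (y : Pi n 1) : bool :=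
  [exists x : Pi n 1,
     (Pi_type x == (n - d * (n %/ d), nseq (n %/ d) d))%N && (x <= y)%O].

Lemma pointed_divisible_act n d s (y : Pi n 1) :
  pointed_divisible d y -> pointed_divisible d (Pi_act s y).
Proof.
case/existsP=> x /andP[tx xy]; apply/existsP; exists (Pi_act s x).
rewrite Pi_le_act // andbT; move: tx.
by rewrite -{1 2}[x]reprPi Pi_actE !Pi_typeE wtype_wact.
Qed.

Section Rank.
Context {disp : Order.disp_t} {T : porderType disp}.
Variable S : {pred T}.

Definition minimal_in (x : T) : Prop :=
  x \in S /\ forall y, y \in S -> (y <= x)%O -> y = x.

Definition covered_in (x y : T) : Prop :=
  [/\ x \in S, y \in S, (x < y)%O &
      forall z, z \in S -> ~~ (x < z < y)%O].

Definition is_rank (r : T -> nat) : Prop :=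
  (forall x, minimal_in x -> r x = 0) /\
  (forall x y, covered_in x y -> r y = (r x).+1).

End Rank.

(* Main.v *)
(* A weighted partition is the same thing as a labelling [b] of {0, ..., n}
   together with a weight function [w], and in these terms the order is a
   condition on pairs of equally labelled elements. In both posets
   floor(n/d) - (number of nonzero blocks) is a rank function, which [Z] visibly
   preserves. Indeed all nonzero blocks have size divisible by d, so there are
   at most floor(n/d) of them; if [P < Q], merging two blocks of [P] gives a
   member of the poset still below [Q], so a cover merges exactly two blocks;
   and a balanced partition with fewer than floor(n/d) nonzero blocks has a
   block from which a balanced block of size d can be split off, so that it is
   not minimal. The splitting also shows that [Z] lands in the pointed
   d-divisible poset, and surjectivity amounts to weighting each block of size
   divisible by d equidistributedly. *)

Require Import Defs.
From mathcomp Require Import all_boot all_order all_algebra all_fingroup.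
From mathcomp Require Import generic_quotient zify.

Set Implicit Arguments.
Unset Strict Implicit.
Unset Printing Implicit Defensive.

Import Order.TTheory GRing.Theory.

Definition equidistributed m (I : finType) (w : I -> Zmod m) (A : {set I}) : Prop :=
  forall v v', #|[set k in A | w k == v]| = #|[set k in A | w k == v']|.

(** * Labellings *)

Section Labelling.
Variables (n m : nat) (T : finType).
Implicit Types (b : 'I_n.+1 -> T) (w : 'I_n.+1 -> Zmod m) (t : T).

Definition fiber b t : {set 'I_n.+1} := [set k | b k == t].

Definition label_weight b w k : option (Zmod m) :=
  if b k == b ord0 then None else Some (w k).

Definition label_block b w t : wblock n m :=
  [set (k, label_weight b w k) | k in fiber b t].

Lemma mem_label_block b w t k a :
  ((k, a) \in label_block b w t) = (b k == t) && (a == label_weight b w k).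
Proof.
apply/imsetP/andP => [[j]|[/eqP kt /eqP ->]].
  by rewrite inE => /eqP jt [-> ->]; rewrite jt !eqxx.
by exists k; rewrite // inE kt.
Qed.

Lemma elt0_label_block b w t : (elt0 n m \in label_block b w t) = (t == b ord0).
Proof. by rewrite mem_label_block /label_weight eqxx andbT eq_sym. Qed.

(** Only labels in [codom b] are used: any other label has an empty fiber and would produce the
    forbidden block [set0]. *)
Lemma is_wpart_labelled b w :
  is_wpart [set label_block b w t | t in codom b].
Proof.
apply/wpartP; split.
- move=> _ /imsetP[_ /codomP[k ->] ->]; apply/set0Pn.
  by exists (k, label_weight b w k); rewrite mem_label_block !eqxx.
- move=> k; exists (label_block b w (b k)), (label_weight b w k).
    exact/imset_f/codom_f.
  by rewrite mem_label_block !eqxx.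
- move=> _ _ k a a' /imsetP[t _ ->] /imsetP[t' _ ->].
  rewrite !mem_label_block => /andP[/eqP<- /eqP->] /andP[/eqP<- /eqP->].
  by split.
- exists (label_block b w (b ord0)); first exact/imset_f/codom_f.
  by rewrite elt0_label_block.
- move=> _ [k a] /imsetP[t _ ->]; rewrite mem_label_block elt0_label_block.
  by case/andP=> /eqP<- /eqP->; rewrite /= /label_weight; case: (b k == _).
Qed.

(* The label of 0 marks the zero block, where [w] is ignored. *)
Definition labelled b w : wpart n m := WPart (is_wpart_labelled b w).

Lemma label_block_inj b w : {in codom b &, injective (label_block b w)}.
Proof.
move=> _ t' /codomP[k ->] _ E.
have : (k, label_weight b w k) \in label_block b w (b k).
  by rewrite mem_label_block !eqxx.
by rewrite E mem_label_block => /andP[/eqP].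
Qed.

Lemma card_label_block b w t : #|label_block b w t| = #|fiber b t|.
Proof. by apply: card_imset => i j []. Qed.

Lemma zero_block_labelled b w :
  zero_block (labelled b w) = label_block b w (b ord0).
Proof.
apply/esym/eqP; rewrite zero_blockP ?elt0_label_block //.
exact/imset_f/codom_f.
Qed.

Lemma wblocks_labelled_nonzero b w :
  wblocks (labelled b w) :\ zero_block (labelled b w)
  = [set label_block b w t | t in [predD1 mem (codom b) & b ord0]].
Proof.
rewrite zero_block_labelled; apply/setP => B; rewrite !inE.
apply/andP/imsetP => [[Bn0 /imsetP[t tb Bt]]|[t]].
  exists t => //; rewrite inE tb andbT.
  by apply: contraNneq Bn0 => t0; rewrite Bt t0.
rewrite inE => /andP[tn0 tb] ->; split; last exact: imset_f.
by apply: contraNneq tn0 => /(label_block_inj tb (codom_f _ _)) ->.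
Qed.

(** The successor accounts for the label of 0, whose block is absent from the second entry of the
    type. *)
Lemma size_wtype_labelled b w :
  (size (wtype (labelled b w)).2).+1 = #|codom b|.
Proof.
rewrite size_sort size_map -cardE wblocks_labelled_nonzero card_in_imset.
  by rewrite (cardD1 (b ord0) (mem (codom b))) codom_f.
by move=> s t; rewrite !inE => /andP[_ sb] /andP[_ tb]; apply: label_block_inj.
Qed.

Lemma mem_wtype_labelled b w t : t \in codom b -> t != b ord0 ->
  #|fiber b t| \in (wtype (labelled b w)).2.
Proof.
move=> tb tn0; rewrite mem_sort -(card_label_block b w).
apply: map_f; rewrite mem_enum wblocks_labelled_nonzero; apply: imset_f.
by rewrite inE tn0.
Qed.

Lemma wtype_labelled b w d :
  (forall t, t \in codom b -> t != b ord0 -> #|fiber b t| = d) ->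
  wtype (labelled b w) = (#|fiber b (b ord0)|.-1, nseq #|codom b|.-1 d).
Proof.
move=> bd; rewrite [LHS]surjective_pairing; congr (_, _).
  rewrite /= zero_block_labelled -(card_label_block b w).
  by rewrite [in RHS](cardsD1 (elt0 n m)) elt0_label_block eqxx.
have /all_pred1P -> : all (pred1 d) (wtype (labelled b w)).2.
  apply/allP => k; rewrite mem_sort => /mapP[B].
  rewrite mem_enum wblocks_labelled_nonzero => /imsetP[t].
  rewrite inE => /andP[tn0 tb] -> ->.
  by rewrite /= card_label_block bd.
by rewrite -(size_wtype_labelled b w).
Qed.

Lemma wbalanced_labelled b w :
  reflect (forall t, t != b ord0 -> equidistributed w (fiber b t))
          (wbalanced (labelled b w)).
Proof.
have cnt t v : t != b ord0 ->
    #|[set p in label_block b w t | p.2 == Some v]|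
    = #|[set k in fiber b t | w k == v]|.
  move=> tn0; pose g k : welt n m := (k, label_weight b w k).
  have gI : injective g by move=> i j [].
  rewrite -[RHS](card_imset _ gI); apply: eq_card => -[k a]; rewrite !inE.
  apply/andP/imsetP => [[]|[j]].
    rewrite mem_label_block => /andP[kt /eqP ->] /=.
    rewrite /label_weight (eqP kt) (negbTE tn0) => /eqP[wv].
    by exists k; rewrite /g ?inE ?kt ?wv /= ?eqxx // /label_weight (eqP kt) (negbTE tn0) wv.
  rewrite !inE => /andP[jt wv] [-> ->]; rewrite mem_label_block jt eqxx.
  by rewrite /label_weight (eqP jt) (negbTE tn0) (eqP wv) /= eqxx.
apply: (iffP forall_inP) => [bal t tn0 v v'|bal B].
  (* A label outside the image has an empty fiber, so both counts vanish. *)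
  have [tb|tb] := boolP (t \in codom b).
    have /forallP/(_ v)/forallP/(_ v')/eqP := bal _ (imset_f (label_block b w) tb).
    by rewrite !cnt.
  suff E u : [set k in fiber b t | w k == u] = set0 by rewrite !E.
  by apply/setP => k; rewrite !inE; apply: contraNF tb => /andP[/eqP<- _]; apply: codom_f.
case/imsetP=> t tb ->; apply/forallP => v; apply/forallP => v'.
(* In the zero block no element carries a weight, so all counts are 0. *)
have [t0|tn0] := eqVneq t (b ord0); last by rewrite !cnt // (bal t tn0 v v').
suff E u : [set p in label_block b w t | p.2 == Some u] = set0 by rewrite !E.
apply/setP => -[k a]; rewrite !inE mem_label_block t0 /label_weight.
by case: eqP => //= _; apply/negP => /andP[/eqP->].
Qed.

End Labelling.

(** * Weighted partitions and their order in terms of labellings *)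

Lemma wpart_labelled n m (P : wpart n m) :
  exists (b : 'I_n.+1 -> wblock n m) w, P = labelled b w.
Proof.
have [P0 cP uP [B0 B0P zB0] kP] := wpartP _ (valP P).
have [f fP] : exists f : 'I_n.+1 -> wblock n m * option (Zmod m),
    forall k, (f k).1 \in wblocks P /\ (k, (f k).2) \in (f k).1.
  apply: (@fin_all_exists _ _ (fun k q => q.1 \in wblocks P /\ (k, q.2) \in q.1)).
  by move=> k; have [B [a BP kB]] := cP k; exists (B, a).
(* Each element is labelled by its own block. The default weight 0 is taken only in the zero block,
   where [label_weight] ignores it. *)
pose b k := (f k).1; pose w k := odflt 0%R (f k).2.
have fE B k a : B \in wblocks P -> (k, a) \in B -> b k = B /\ (f k).2 = a.
  by move=> BP kB; have [fP1 fP2] := fP k; apply: uP fP2 kB.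
have b0 : b ord0 = B0 by have [] := fE _ _ _ B0P zB0.
have wE k : label_weight b w k = (f k).2.
  rewrite /label_weight /w; have [bP kb] := fP k.
  have := kP _ _ bP kb; rewrite /= b0.
  case: ((f k).2) => [u|] /=.
    by move=> zb; case: eqP => // E; move: zb; rewrite -/(b k) E zB0.
  by rewrite eqxx => /esym zb; rewrite /b; have [-> _] := uP _ _ _ _ _ bP B0P zb zB0; rewrite eqxx.
exists b, w; apply: val_inj; apply/setP => B /=.
have blockE k : label_block b w (b k) = b k.
  apply/setP => -[j a]; rewrite mem_label_block wE; have [bP _] := fP k.
  apply/andP/idP => [[/eqP jk /eqP ->]|jb].
    by rewrite -jk; have [] := fP j.
  by have [-> ->] := fE _ _ _ bP jb.
apply/idP/imsetP => [BP|[_ /codomP[k ->] ->]].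
  have /set0Pn[[k a] kB] := P0 _ BP; have [<- _] := fE _ _ _ BP kB.
  by exists (b k); rewrite ?codom_f ?blockE.
by rewrite blockE; have [] := fP k.
Qed.

(** For a block inside a nonzero block of the upper partition, a suitable shift exists exactly when
    [w' - w] is constant on it; inside the zero block, erasing always works. *)
Lemma wle_labelled n m (T T' : finType) (b : 'I_n.+1 -> T) (b' : 'I_n.+1 -> T')
    (w w' : 'I_n.+1 -> Zmod m) :
  reflect (forall i j, b i = b j -> b' i = b' j /\
             (b' i = b' ord0 \/ (w' i - w i = w' j - w j)%R))
          (wle (labelled b w) (labelled b' w')).
Proof.
apply: (iffP (wleP _ _)) => [le i j ij|le].
  have [_ /imsetP[t' _ ->] BC] := le _ (imset_f (label_block b w) (codom_f b i)).
  have iB : (i, label_weight b w i) \in label_block b w (b i).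
    by rewrite mem_label_block !eqxx.
  have jB : (j, label_weight b w j) \in label_block b w (b i).
    by rewrite mem_label_block ij !eqxx.
  case: BC => [/subsetP eB|[v /subsetP sB]].
    have := eB _ (imset_f (fun p : welt n m => (p.1, None)) iB).
    have := eB _ (imset_f (fun p : welt n m => (p.1, None)) jB).
    rewrite !mem_label_block /label_weight /= => /andP[/eqP jt _] /andP[/eqP it].
    by rewrite it jt; case: (t' =P _) => // -> _; split=> //; left.
  have := sB _ (shift_mem v iB); have := sB _ (shift_mem v jB).
  rewrite !mem_label_block /= /label_weight -ij.
  move=> /andP[/eqP jt +] /andP[/eqP it]; rewrite it jt.
  case: (t' =P b' ord0) => [->|t'n0]; first by split=> //; left.
  case: (b i =P b ord0) => //= _ /eqP[<-] /eqP[<-]; split=> //; right.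
  by rewrite ![(_ + v)%R]addrC !addrK.
move=> _ /imsetP[_ /codomP[i ->] ->]; exists (label_block b' w' (b' i)).
  exact/imset_f/codom_f.
have [i0|in0] := eqVneq (b' i) (b' ord0).
  left; apply/subsetP => _ /imsetP[[j a] /[!mem_label_block] /andP[/eqP ji _] ->].
  by have [ji' _] := le _ _ ji; rewrite mem_label_block /label_weight /= ji' i0 !eqxx.
right; exists (w' i - w i)%R.
apply/subsetP => _ /imsetP[[j a] /[!mem_label_block] /andP[/eqP ji /eqP ->] ->].
have [ji' [/eqP|dw]] := le _ _ ji; first by rewrite ji' (negbTE in0).
rewrite mem_label_block /label_weight /= ji' (negbTE in0) eqxx ji.
(* A block containing 0 cannot lie in a nonzero block, so [i] is weighted. *)
case: (b i =P b ord0) => [i0 |_ /=]; first by have [/eqP] := le _ _ i0; rewrite (negbTE in0).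
by rewrite -dw addrC subrK.
Qed.

Lemma Pi_labelled n m (x : Pi n m) :
  exists (b : 'I_n.+1 -> wblock n m) w, x = pclass (labelled b w).
Proof.
have [b [w E]] := wpart_labelled (repr x).
by exists b, w; rewrite -E reprPi.
Qed.

Lemma wzero_labelled n m (T : finType) (b : 'I_n.+1 -> T) (w : 'I_n.+1 -> Zmod m) :
  wzero (labelled b w) = labelled b (fun=> 0%R).
Proof.
apply: val_inj; rewrite /= -imset_comp; apply: eq_imset => t /=.
rewrite /zero /label_block -imset_comp; apply: eq_imset => k /=.
by rewrite /label_weight; case: eqP.
Qed.

(** * Merging two blocks *)

(** The label [s] disappears and [t] survives; a merge with the zero block takes [t] to be the label
    of 0, so that this label does not change. *)
Definition relabel n (T : finType) (b : 'I_n.+1 -> T) (s t : T) k : T :=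
  if b k == s then t else b k.

Section Merging.
Variables (n m : nat) (T : finType).
Implicit Types (b : 'I_n.+1 -> T) (w : 'I_n.+1 -> Zmod m) (s t : T).

Lemma fiber_relabel b s t r : s != t ->
  fiber (relabel b s t) r
  = if r == t then fiber b s :|: fiber b t
    else if r == s then set0 else fiber b r.
Proof.
move=> st; apply/setP => k; rewrite !inE /relabel.
have [->|rt] := eqVneq r t.
  by rewrite !inE; case: (b k == s); rewrite ?eqxx.
have [->|rs] := eqVneq r s.
  rewrite inE; case: (eqVneq (b k) s) => [_|/negbTE -> //].
  by rewrite eq_sym (negbTE st).
rewrite inE; case: (eqVneq (b k) s) => [->|//].
by rewrite ![_ == r]eq_sym (negbTE rt) (negbTE rs).
Qed.

Lemma disjoint_fiber b s t : s != t -> fiber b s :&: fiber b t = set0.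
Proof.
move=> st; apply/setP => k; rewrite !inE; apply/negP => /andP[/eqP -> ].
exact/negP.
Qed.

Lemma card_codom_relabel b s t : s \in codom b -> t \in codom b -> s != t ->
  #|codom b| = #|codom (relabel b s t)|.+1.
Proof.
move=> sb /codomP[j tj] st; rewrite (cardD1 s) sb; congr _.+1.
apply: eq_card => r; rewrite !inE; apply/andP/codomP => [[rs /codomP[k rk]]|[k ->]].
  by exists k; rewrite /relabel -rk (negbTE rs).
rewrite /relabel; have [ks|//] := eqVneq (b k) s; last by rewrite codom_f.
by rewrite eq_sym st tj codom_f.
Qed.

Lemma wle_relabel b w s t : wle (labelled b w) (labelled (relabel b s t) w).
Proof. by apply/wle_labelled => i j ij; rewrite !subrr /relabel ij; split; last right. Qed.

Lemma wle_relabelN b w s t : s \in codom b -> t \in codom b -> s != t ->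
  ~~ wle (labelled (relabel b s t) w) (labelled b w).
Proof.
move=> /codomP[i si] /codomP[j tj] st; apply/negP => /wle_labelled/(_ i j).
rewrite /relabel -si -tj eqxx eq_sym (negbTE st) => /(_ erefl)[E _].
by move: st; rewrite E eqxx.
Qed.

(** Below a strictly larger partition, two blocks share an upper block. Replacing [w] by the
    equivalent [u] fixes their relative shift to the one the upper partition requires. *)
Lemma wle_merge (T' : finType) (b' : 'I_n.+1 -> T') w' b w :
  wle (labelled b w) (labelled b' w') -> ~~ wle (labelled b' w') (labelled b w) ->
  exists u s t, [/\ [/\ s \in codom b, t \in codom b & s != t], s != b ord0,
    wequiv (labelled b w) (labelled b u)
    & wle (labelled (relabel b s t) u) (labelled b' w')].
Proof.
move=> /wle_labelled le nle.
have [i [j [bij ij i0 b0]]] : exists i j, [/\ b' i = b' j, b i != b j,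
    b i != b ord0 & b' i = b' ord0 -> b j = b ord0].
  (* Otherwise both partitions have the same underlying blocks, and negating the weight differences
     gives the reverse inequality. *)
  have [i [j [bij ij]]] : exists i j, b' i = b' j /\ b i != b j.
    have /existsP[i /existsP[j /andP[/eqP ? ?]]] :
        [exists i, exists j, (b' i == b' j) && (b i != b j)].
      apply: contraNT nle => no; apply/wle_labelled => i j ij'.
      have inj k l : b' k = b' l -> b k = b l.
        move=> kl; apply/eqP; apply: contraNT no => bkl.
        by apply/existsP; exists k; apply/existsP; exists l; rewrite kl eqxx.
      have ij := inj _ _ ij'; split=> //; have [_ [i0|dw]] := le _ _ ij.
        by left; apply: inj.
      by right; rewrite -opprB dw opprB.
    by exists i, j.
  (* Inside the upper zero block, one of the two elements lies outside the lower zero block and is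
     paired with 0. *)
  have [i0'|i0'] := eqVneq (b' i) (b' ord0).
    have [i0|i0] := eqVneq (b i) (b ord0); last by exists i, ord0.
    by exists j, ord0; rewrite -bij i0' -i0 eq_sym ij.
  exists i, j; split=> //; last by move/eqP: i0' => /[apply].
  by apply: contraNneq i0' => /le[->].
(* Outside the blocks that end in the zero block of the upper partition, [w']
   is a legitimate choice of weights for the lower one. *)
pose u k := if b' k == b' ord0 then w k else w' k.
have du k l : b k = b l -> (u k - w k = u l - w l)%R.
  move=> kl; have [kl' [k0|dw]] := le _ _ kl; rewrite /u -kl'.
    by rewrite k0 eqxx !subrr.
  by case: eqP; rewrite ?subrr.
exists u, (b i), (b j); split=> //; first by rewrite !codom_f.
  rewrite wequivE; apply/andP; split; apply/wle_labelled => k l kl.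
    by split=> //; right; apply: du.
  by split=> //; right; rewrite -opprB (du _ _ kl) opprB.
apply/wle_labelled => k l.
(* Merging amounts to replacing every element of the block of [i] by [j], which preserves the upper
   label. *)
have key x : b' x = b' (if b x == b i then j else x).
  by case: eqP => // /le[-> _].
have relE x : relabel b (b i) (b j) x = b (if b x == b i then j else x).
  by rewrite /relabel; case: eqP.
rewrite !relE => /le[kl' _].
have kl : b' k = b' l by rewrite key kl' -key.
split=> //; rewrite /u kl; case: eqP => [->|_]; first by left.
by right; rewrite !subrr.
Qed.

End Merging.

(** * The number of nonzero blocks as a corank *)

Definition nonzero_blocks n m (x : Pi n m) : nat := size (Pi_type x).2.

Lemma nonzero_blocks_labelled n m (T : finType) (b : 'I_n.+1 -> T)
    (w : 'I_n.+1 -> Zmod m) :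
  (nonzero_blocks (pclass (labelled b w))).+1 = #|codom b|.
Proof. by rewrite /nonzero_blocks Pi_typeE size_wtype_labelled. Qed.

(** By closure under merging, the upper element of a cover is itself a merge of two blocks of the
    lower one. The bound by [a] makes the truncated subtraction exact. *)
Lemma is_rank_nonzero_blocks n m (S : pred (Pi n m)) a :
  (forall x, S x -> nonzero_blocks x <= a) ->
  (forall x, minimal_in S x -> nonzero_blocks x = a) ->
  (forall (b : 'I_n.+1 -> wblock n m) (w : 'I_n.+1 -> Zmod m) s t,
     s \in codom b -> t \in codom b -> s != t -> s != b ord0 ->
     S (pclass (labelled b w)) -> S (pclass (labelled (relabel b s t) w))) ->
  is_rank S (fun x => a - nonzero_blocks x).
Proof.
move=> leS minS mergeS; split=> [x /minS ->|x y]; first exact: subnn.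
have [b [w ->]] := Pi_labelled x; have [b' [w' ->]] := Pi_labelled y.
case=> Sx Sy; rewrite lt_leAnge !Pi_leE => /andP[le nle] cov.
have [u [s [t [[sb tb st] s0 wu leu]]]] := wle_merge le nle.
have Exu : pclass (labelled b w) = pclass (labelled b u) by apply/eqP; rewrite eqPi.
rewrite Exu in Sx cov *; pose z := pclass (labelled (relabel b s t) u).
have Sz : S z := mergeS _ _ _ _ sb tb st s0 Sx.
have := cov z Sz.
rewrite lt_leAnge !Pi_leE wle_relabel wle_relabelN //= lt_neqAle Pi_leE leu andbT.
rewrite negbK => /eqP <-.
have := nonzero_blocks_labelled b u; have := leS _ Sx.
rewrite (card_codom_relabel sb tb st) -(nonzero_blocks_labelled _ u) -/z.
lia.
Qed.

(** * Labellings with fibers of size divisible by d *)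

Section DivisibleFibers.
Variables (n d : nat) (T : finType) (b : 'I_n.+1 -> T).
Hypothesis d_gt0 : 0 < d.
Hypothesis dvd_b : forall t, t != b ord0 -> d %| #|fiber b t|.

Lemma sum_card_fiberT : \sum_(t in codom b) #|fiber b t| = n.+1.
Proof.
rewrite -[RHS]card_ord -sum1_card.
rewrite (partition_big b (mem (codom b))) => [|k _]; last exact: codom_f.
by apply: eq_bigr => t _; rewrite -sum1_card; apply: eq_bigl => k; rewrite inE.
Qed.

Lemma sum_card_fiber :
  #|fiber b (b ord0)| + \sum_(t in codom b | t != b ord0) #|fiber b t| = n.+1.
Proof. by rewrite -[RHS]sum_card_fiberT [RHS](bigD1 (b ord0)) ?codom_f. Qed.

Lemma card_nonzero_labels : #|codom b| = #|[pred t in codom b | t != b ord0]|.+1.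
Proof.
rewrite (cardD1 (b ord0)) codom_f; congr _.+1.
by apply: eq_card => t; rewrite !inE andbC.
Qed.

Lemma card_fiber_gt0 t : t \in codom b -> 0 < #|fiber b t|.
Proof. by case/codomP=> k ->; apply/card_gt0P; exists k; rewrite inE. Qed.

Lemma card_fiber_ge t : t \in codom b -> t != b ord0 -> d <= #|fiber b t|.
Proof. by move=> tb t0; rewrite dvdn_leq ?card_fiber_gt0 ?dvd_b. Qed.

(** Among the [n.+1] elements, the fiber of 0 takes at least one and every other nonempty fiber at
    least [d]. *)
Lemma card_codom_le : #|codom b| <= (n %/ d).+1.
Proof.
rewrite card_nonzero_labels ltnS leq_divRL // -ltnS.
rewrite -[X in _ < X]sum_card_fiber -sum_nat_const -add1n.
rewrite leq_add ?card_fiber_gt0 ?codom_f //.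
by apply: leq_sum => t /andP[tb t0]; apply: card_fiber_ge.
Qed.

(** A larger multiple of [d] would be at least [2 * d], and the nonzero blocks would together have
    more than [n] elements. *)
Lemma card_fiber_eq t : #|codom b| = (n %/ d).+1 ->
  t \in codom b -> t != b ord0 -> #|fiber b t| = d.
Proof.
move=> Eb tb t0; apply/eqP; rewrite eq_sym eqn_leq card_fiber_ge //=.
have /dvdnP[q Eq] := dvd_b t0.
rewrite leqNgt; apply/negP => lt.
have Ed : n %/ d * d = \sum_(s in codom b | s != b ord0) d.
  by rewrite sum_nat_const -[n %/ d]/(n %/ d).+1.-1 -Eb card_nonzero_labels.
have := sum_card_fiber; have := card_fiber_gt0 (codom_f b ord0).
rewrite (bigD1 t) ?tb //=; move: Ed; rewrite (bigD1 t) ?tb //=.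
have : \sum_(s | (s \in codom b) && (s != b ord0) && (s != t)) d
       <= \sum_(s | (s \in codom b) && (s != b ord0) && (s != t)) #|fiber b s|.
  by apply: leq_sum => s /andP[/andP[sb s0] _]; apply: card_fiber_ge.
have := ltn_ceil n d_gt0.
have : q != 1 by apply: contraTneq lt => q1; rewrite Eq q1 mul1n ltnn.
rewrite mulSn; move: (n %/ d * d) => nd; move: lt; rewrite Eq.
move: (\sum_(s | _) d) (\sum_(s | _) #|fiber b s|) => sd sf.
by case: q {Eq} => [|[|q]]; rewrite ?mul0n // !mulSn; lia.
Qed.

Lemma card_zero_fiber_eq : #|codom b| = (n %/ d).+1 ->
  #|fiber b (b ord0)|.-1 = n - d * (n %/ d).
Proof.
move=> Eb; have := sum_card_fiber.
rewrite (eq_bigr (fun=> d)) => [|t /andP[tb t0]]; last exact: card_fiber_eq.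
have -> : \sum_(t in codom b | t != b ord0) d = n %/ d * d.
  by rewrite sum_nat_const -[n %/ d]/(n %/ d).+1.-1 -Eb card_nonzero_labels.
by have := card_fiber_gt0 (codom_f b ord0); lia.
Qed.

(** Pigeonhole over all labels, that of 0 included: fibers of size at most [d] would cover at most
    [n] elements. Strictness leaves an element over when [d] of them are removed. *)
Lemma exists_big_fiber : #|codom b| <= n %/ d ->
  exists2 t, t \in codom b & d < #|fiber b t|.
Proof.
move=> lt; apply/exists_inP; apply: contraLR lt; rewrite -ltnNge => /exists_inPn le.
rewrite ltn_divLR // -[X in X <= _]sum_card_fiberT -sum_nat_const.
by apply: leq_sum => t tb; rewrite leqNgt le.
Qed.

End DivisibleFibers.

(** * Equidistributed weight functions *)

Lemma card_equidistributed m (I : finType) (A : {set I}) (w : I -> Zmod m) v :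
  0 < m -> equidistributed w A ->
  #|A| = m * #|[set k in A | w k == v]|.
Proof.
move=> m_gt0 eqw; rewrite -sum1_card (partition_big w predT) //=.
rewrite (eq_bigr (fun=> #|[set k in A | w k == v]|)) => [|v' _].
  by rewrite sum_nat_const card_ord; congr (_ * _); exact: prednK.
by rewrite (eqw v v') -sum1_card; apply: eq_bigl => k; rewrite inE.
Qed.

(** A bijection of [A] with ['I_q * Zmod m] provides the weight as second coordinate. *)
Lemma exists_equidistributed m (I : finType) (A : {set I}) : 0 < m -> m %| #|A| ->
  exists w : I -> Zmod m, equidistributed w A.
Proof.
move=> m_gt0 /dvdnP[q Aq].
have [Aqm] : #|A| = #|{: 'I_q * Zmod m}| by rewrite card_prod !card_ord prednK.
pose g (p : 'I_q * Zmod m) : I :=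
  enum_val (cast_ord (esym Aqm) (enum_rank p)).
have gI : injective g.
  by move=> p p' /enum_val_inj /cast_ord_inj /enum_rank_inj.
have gA p : g p \in A by apply: enum_valP.
have gS k : k \in A -> exists p, g p = k.
  move=> kA; exists (enum_val (cast_ord Aqm (enum_rank_in kA k))).
  by rewrite /g enum_valK cast_ordK enum_rankK_in.
pose w k : Zmod m := if [pick p | g p == k] is Some p then p.2 else 0%R.
have wg p : w (g p) = p.2.
  by rewrite /w; case: pickP => [p' /eqP/gI -> //|/(_ p)]; rewrite eqxx.
exists w; suff cnt v : #|[set k in A | w k == v]| = q by move=> v v'; rewrite !cnt.
rewrite -[RHS]card_ord.
have hI : injective (fun i : 'I_q => g (i, v)) by move=> i i' /gI[].
rewrite -(card_codom hI); apply: eq_card => k; rewrite !inE.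
apply/andP/codomP => [[/gS[[i u] <-]]|[i ->]].
  by rewrite wg => /eqP /= ->; exists i.
by rewrite gA wg.
Qed.

(** * Splitting off a balanced block of size d *)

Section Splitting.
Variables (n d : nat) (T : finType) (b : 'I_n.+1 -> T) (w : 'I_n.+1 -> Zmod d).
Variables (t : T) (g : Zmod d -> 'I_n.+1).
Hypothesis g_inj : injective g.
Hypothesis g_fiber : forall v, b (g v) = t.
Hypothesis g_neq0 : forall v, g v != ord0.
Hypothesis g_weight : t != b ord0 -> forall v, w (g v) = v.

(* The fiber over [t] loses the elements [g v], which form the new block [None]
   and receive each weight once. *)
Definition split_label k : option T := if k \in codom g then None else Some (b k).

Definition split_weight k : Zmod d :=
  if [pick v | g v == k] is Some v then v else w k.

Lemma split_weight_in v : split_weight (g v) = v.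
Proof.
by rewrite /split_weight; case: pickP => [v' /eqP/g_inj //|/(_ v)]; rewrite eqxx.
Qed.

Lemma split_weight_out k : k \notin codom g -> split_weight k = w k.
Proof.
rewrite /split_weight; case: pickP => // v /eqP <-.
by rewrite codom_f.
Qed.

Lemma split_weight_nonzero k : t != b ord0 -> split_weight k = w k.
Proof.
move=> t0; have [/codomP[v ->]|] := boolP (k \in codom g).
  by rewrite split_weight_in g_weight.
exact: split_weight_out.
Qed.

Lemma split_label0 : split_label ord0 = Some (b ord0).
Proof.
rewrite /split_label; case: codomP => // -[v g0].
by have := g_neq0 v; rewrite -g0 eqxx.
Qed.

Lemma split_label_Some k t' :
  (split_label k == Some t') = (k \notin codom g) && (b k == t').
Proof. by rewrite /split_label; case: (k \in codom g). Qed.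

Lemma split_label_None k : (split_label k == None) = (k \in codom g).
Proof. by rewrite /split_label; case: (k \in codom g). Qed.

(** Weights change only if the new block comes out of the zero block, where the order puts no
    condition on them. *)
Lemma wle_split : wle (labelled split_label split_weight) (labelled b w).
Proof.
apply/wle_labelled => i j; rewrite /split_label.
case: ifP => [/codomP[v ->]|/negbT ni]; case: ifP => [/codomP[v' ->]|/negbT nj] //.
  move=> _; rewrite !g_fiber; split=> //; have [->|t0] := eqVneq t (b ord0); first by left.
  by right; rewrite !split_weight_nonzero // !subrr.
by case=> ->; split=> //; right; rewrite !split_weight_out // !subrr.
Qed.

Lemma wbalanced_split :
  wbalanced (labelled b w) -> wbalanced (labelled split_label split_weight).
Proof.
move=> /wbalanced_labelled bal; apply/wbalanced_labelled.
rewrite split_label0 => -[t'|] t'0 v v'; last first.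
  suff card1 u : #|[set k in fiber split_label None | split_weight k == u]| = 1.
    by rewrite !card1.
  apply/eqP/cards1P; exists (g u); apply/setP => k; rewrite !inE split_label_None.
  apply/andP/eqP => [[/codomP[u' ->]]|->]; first by rewrite split_weight_in => /eqP ->.
  by rewrite codom_f split_weight_in.
have {}t'0 : t' != b ord0 by apply: contraNneq t'0 => ->.
(* The fiber over [t] loses exactly one element of each weight, namely [g u]; the other fibers are
   unchanged. *)
suff cnt u : (t' == t) + #|[set k in fiber split_label (Some t') | split_weight k == u]|
           = #|[set k in fiber b t' | w k == u]|.
  by apply: (@addnI (t' == t)); rewrite !cnt; apply: bal.
have [tt'|tt'] := eqVneq t' t; last first.
  apply: eq_card => k; rewrite !inE split_label_Some.
  have [/codomP[u' ->]|kg] := boolP (k \in codom g); last by rewrite split_weight_out.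
  by rewrite g_fiber eq_sym (negbTE tt').
rewrite tt' in t'0 *; rewrite (cardsD1 (g u) [set k in fiber b t | _]).
rewrite !inE g_fiber g_weight // !eqxx /=; congr _.+1.
apply: eq_card => k; rewrite !inE split_label_Some split_weight_nonzero // -andbA.
have [wk|] := eqVneq (w k) u; last by rewrite !andbF.
congr (~~ _ && _); apply/codomP/eqP => [[u' ku']|->]; last by exists u.
by rewrite ku' -wk ku' g_weight.
Qed.

(** [None] is a new label, and [t] survives because [g] uses up only [d] elements of its fiber. *)
Lemma card_codom_split : d < #|fiber b t| -> 0 < d ->
  #|codom split_label| = #|codom b|.+1.
Proof.
move=> lt d_gt0; have -> : #|codom split_label| = #|None |: [set Some r | r in codom b]|.
  apply: eq_card => -[r|]; rewrite !inE /=.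
    apply/codomP/imsetP => [[k /esym/eqP]|[_ /codomP[k ->] [->]]].
      by rewrite split_label_Some => /andP[_ /eqP<-]; exists (b k); rewrite ?codom_f.
    have [/codomP[v ->]|kg] := boolP (k \in codom g); last first.
      by exists k; apply/esym/eqP; rewrite split_label_Some kg eqxx.
    rewrite g_fiber.
    have /subsetPn[j] : ~~ (fiber b t \subset codom g).
      apply: contraL lt => /subset_leq_card; rewrite card_codom // card_ord -leqNgt.
      by rewrite prednK.
    by rewrite inE => jt jg; exists j; apply/esym/eqP; rewrite split_label_Some jg.
  by apply/codomP; exists (g 0%R); rewrite /split_label codom_f.
rewrite cardsU1 card_imset; last by move=> r r' [].
by case: imsetP => // -[].
Qed.

End Splitting.

Lemma balanced_labels_dvd n d (T : finType) (b : 'I_n.+1 -> T) (w : 'I_n.+1 -> Zmod d) :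
  0 < d -> wbalanced (labelled b w) ->
  forall t, t != b ord0 -> d %| #|fiber b t|.
Proof.
move=> d_gt0 /wbalanced_labelled bal t t0.
by rewrite (card_equidistributed 0%R d_gt0 (bal t t0)) dvdn_mulr.
Qed.

(** * The balanced poset: block count, refinement and rank *)

Section Balanced.
Variables (n d : nat).
Hypothesis d_gt0 : 0 < d.
Implicit Types x : Pi n d.

Lemma leq_nonzero_blocks x : balanced x -> nonzero_blocks x <= n %/ d.
Proof.
have [b [w ->]] := Pi_labelled x; rewrite balancedE => bal.
rewrite -ltnS nonzero_blocks_labelled.
exact/(card_codom_le d_gt0)/balanced_labels_dvd/bal.
Qed.

Lemma balanced_split x : balanced x -> nonzero_blocks x < n %/ d ->
  exists z : Pi n d, [/\ balanced z, (z <= x)%O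
    & nonzero_blocks z = (nonzero_blocks x).+1].
Proof.
have [b [w ->]] := Pi_labelled x; rewrite balancedE => bal.
rewrite nonzero_blocks_labelled => /(exists_big_fiber d_gt0)[t tb lt].
have [g [gI gt g0 gw]] : exists g : Zmod d -> 'I_n.+1, [/\ injective g,
    forall v, b (g v) = t, forall v, g v != ord0
  & t != b ord0 -> forall v, w (g v) = v].
  have [t0|t0] := eqVneq t (b ord0).
    (* In the zero block any [d] elements other than 0 will do; as the fiber has more than [d]
       elements, enough remain without 0. *)
    pose s := enum (fiber b t :\ ord0).
    have ss (v : Zmod d) : v < size s.
      rewrite -cardE; move: lt; rewrite (cardsD1 ord0) inE t0 eqxx add1n ltnS.
      by apply: leq_trans; rewrite -[d in _ <= d](prednK d_gt0).
    have gs (v : Zmod d) : nth ord0 s v \in fiber b t :\ ord0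
      by have := mem_nth ord0 (ss v); rewrite mem_enum.
    exists (fun v => nth ord0 s (v : Zmod d)); split=> [v v' /eqP|v|v|]; last by [].
    - by rewrite nth_uniq ?enum_uniq // => /eqP/val_inj.
    - by have := gs v; rewrite !inE => /andP[_ /eqP].
    - by have := gs v; rewrite !inE => /andP[].
  (* In a nonempty balanced block every weight occurs, so one element of each weight can be
     chosen. *)
  have ex v : exists k, (b k == t) && (w k == v).
    have /card_gt0P[k] : 0 < #|[set k in fiber b t | w k == v]|.
      have /wbalanced_labelled/(_ t t0) eqw := bal.
      move: lt; rewrite (card_equidistributed v d_gt0 eqw).
      by case: #|_| => //; rewrite muln0.
    by rewrite !inE; exists k.
  have [g gP] : exists g, forall v, (b (g v) == t) && (w (g v) == v).
    exact: fin_all_exists ex.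
  have gw v : w (g v) = v by have /andP[_ /eqP] := gP v.
  have gt v : b (g v) = t by have /andP[/eqP] := gP v.
  exists g; split=> // [|v]; first exact: can_inj gw.
  by apply: contraNneq t0 => g0; rewrite -(gt v) g0.
exists (pclass (labelled (split_label b g) (split_weight w g))); split.
- by rewrite balancedE; apply: (wbalanced_split gI gt g0 gw).
- by rewrite Pi_leE; apply: (wle_split gI gt gw).
by apply: succn_inj; rewrite !nonzero_blocks_labelled (card_codom_split gI gt).
Qed.

(** Iterated splitting, by induction on the number of nonzero blocks missing from [n %/ d]. *)
Lemma balanced_ge x : balanced x -> exists z : Pi n d,
  [/\ balanced z, (z <= x)%O & nonzero_blocks z = n %/ d].
Proof.
have [k] := ubnP (n %/ d - nonzero_blocks x).
elim: k x => // k IH x lk bx.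
have := leq_nonzero_blocks bx; rewrite leq_eqVlt => /predU1P[E|lt].
  by exists x.
have [z [bz zx Ez]] := balanced_split bx lt.
have [|y [By yz Ey]] := IH z _ bz; first by lia.
by exists y; split=> //; apply: le_trans yz zx.
Qed.

Lemma nonzero_blocks_minimal x :
  minimal_in (fun x => balanced x) x -> nonzero_blocks x = n %/ d.
Proof.
by case=> bx minx; have [z [bz /(minx z bz) <- ->]] := balanced_ge bx.
Qed.

(** Merging preserves balance: weight counts add over two nonzero blocks, and a merge into the zero
    block imposes no condition. *)
Lemma is_rank_balanced :
  is_rank (fun x => balanced x) (fun x => n %/ d - nonzero_blocks x).
Proof.
apply: is_rank_nonzero_blocks.
- exact: leq_nonzero_blocks.
- exact: nonzero_blocks_minimal.
move=> b w s t sb tb st s0; rewrite !balancedE => /wbalanced_labelled bal.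
apply/wbalanced_labelled => r; rewrite {1}/relabel [b ord0 == s]eq_sym (negbTE s0) => r0 v v'.
rewrite fiber_relabel //.
have [rt|_] := eqVneq r t; last first.
  have [_|rs] := eqVneq r s; last exact: bal.
  by apply: eq_card => k; rewrite !inE.
have cnt u : #|[set k in fiber b s :|: fiber b t | w k == u]|
    = #|[set k in fiber b s | w k == u]| + #|[set k in fiber b t | w k == u]|.
  rewrite !setIdE setIUl cardsU.
  by rewrite setIACA disjoint_fiber // set0I cards0 subn0.
by rewrite !cnt (bal s s0 v v') (bal t _ v v') // -rt.
Qed.

End Balanced.

(** * The zeroing map *)

Lemma nonzero_blocks_Z n m (x : Pi n m) : nonzero_blocks (Z x) = nonzero_blocks x.
Proof.
have [b [w ->]] := Pi_labelled x; apply: succn_inj.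
by rewrite ZE wzero_labelled !nonzero_blocks_labelled.
Qed.

Lemma Z_le n m (x y : Pi n m) : (x <= y)%O -> (Z x <= Z y)%O.
Proof.
have [b [w ->]] := Pi_labelled x; have [b' [w' ->]] := Pi_labelled y.
rewrite !ZE !wzero_labelled !Pi_leE => /wle_labelled le.
by apply/wle_labelled => i j /le[-> _]; split=> //; right; rewrite !subrr.
Qed.

Lemma Z_act n m (s : 'S_n) (x : Pi n m) : Z (Pi_act s x) = Pi_act s (Z x).
Proof.
rewrite -[x]reprPi Pi_actE !ZE Pi_actE; congr pclass; apply: val_inj => /=.
rewrite -!imset_comp; apply: eq_imset => B /=.
by rewrite /zero /perm_block -!imset_comp.
Qed.

(** * The image of zeroing and the rank of the pointed divisible poset *)

Section Zeroing.
Variables (n d : nat).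
Hypothesis d_gt0 : 0 < d.

(** Refining to [n %/ d] nonzero blocks forces each of them to have size [d], so zeroing the
    refinement gives a generator. *)
Lemma Z_pointed_divisible (x : Pi n d) : balanced x -> pointed_divisible d (Z x).
Proof.
move=> bx; have [z [bz zx Ez]] := balanced_ge d_gt0 bx.
apply/existsP; exists (Z z); rewrite Z_le // andbT.
have [b [w E]] := Pi_labelled z; rewrite E in bz Ez *.
move: bz; rewrite balancedE => /(balanced_labels_dvd d_gt0) dvd.
have Eb : #|codom b| = (n %/ d).+1 by rewrite -Ez nonzero_blocks_labelled.
rewrite ZE wzero_labelled Pi_typeE (wtype_labelled _ (fun t => card_fiber_eq (t := t) d_gt0 dvd Eb)).
by rewrite (card_zero_fiber_eq d_gt0 dvd Eb) Eb.
Qed.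

(** A nonzero block is a disjoint union of nonzero blocks, each of size [d], of a generator
    below. *)
Lemma pointed_divisible_labelled_dvd (T : finType) (b : 'I_n.+1 -> T) w :
  pointed_divisible d (pclass (labelled b w)) ->
  forall t, t != b ord0 -> d %| #|fiber b t|.
Proof.
case/existsP=> x; have [b' [w' ->]] := Pi_labelled x.
rewrite Pi_typeE Pi_leE => /andP[/eqP ty /wle_labelled le] t t0.
rewrite -sum1_card (partition_big b' (mem (codom b'))) => [|k _]; last exact: codom_f.
apply: (big_ind (fun k => d %| k)) => [//|p q|s /codomP[j ->]]; first exact: dvdn_add.
have [jt|jt] := eqVneq (b j) t; last first.
  rewrite big_pred0 // => k; rewrite inE; apply/negP => /andP[/eqP kt /eqP/le[kj _]].
  by move: jt; rewrite -kj kt eqxx.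
have -> : \sum_(k in fiber b t | b' k == b' j) 1 = #|fiber b' (b' j)|.
  rewrite -sum1_card; apply: eq_bigl => k; rewrite !inE.
  by apply: andb_idl => /eqP/le[-> _]; rewrite jt.
(* The zero block of the generator lies in the upper zero block, hence not in the fiber over [t]. *)
have j0 : b' j != b' ord0 by apply: contraNneq t0 => /le[<- _]; rewrite jt.
have := mem_wtype_labelled w' (codom_f b' j) j0.
by rewrite ty mem_nseq => /andP[_ /eqP ->].
Qed.

Lemma labelled_Z_balanced (T : finType) (b : 'I_n.+1 -> T) w :
  (forall t, t != b ord0 -> d %| #|fiber b t|) ->
  exists2 x : Pi n d, balanced x & Z x = pclass (labelled b w).
Proof.
move=> dvd.
have [f fP] : exists f : T -> 'I_n.+1 -> Zmod d,
    forall t, t != b ord0 -> equidistributed (f t) (fiber b t).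
  apply: (@fin_all_exists _ _
    (fun t f => t != b ord0 -> equidistributed f (fiber b t))) => t.
  have [t0|t0] := eqVneq t (b ord0); first by exists (fun=> 0%R).
  by have [f fP] := exists_equidistributed d_gt0 (dvd t t0); exists f.
(* Each element is weighted by the function chosen for its own block. *)
exists (pclass (labelled b (fun k => f (b k) k))).
  rewrite balancedE; apply/wbalanced_labelled => t t0 v v'.
  have E u : [set k in fiber b t | f (b k) k == u] = [set k in fiber b t | f t k == u].
    by apply/setP => k; rewrite !inE; case: eqP => // ->.
  by rewrite !E; apply: fP.
rewrite ZE wzero_labelled; apply/eqP; rewrite eqPi wequivE.
(* [Zmod 1] has a single element, so all weightings of [b] are equivalent. *)
by apply/andP; split; apply/wle_labelled => i j ij; split; rewrite // !ord1; right.
Qed.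

Lemma dvd_pointed_divisible (T : finType) (b : 'I_n.+1 -> T) w :
  (forall t, t != b ord0 -> d %| #|fiber b t|) ->
  pointed_divisible d (pclass (labelled b w)).
Proof.
by move=> /labelled_Z_balanced-/(_ w)[x bx <-]; apply: Z_pointed_divisible.
Qed.

Lemma Z_surjective (y : Pi n 1) : pointed_divisible d y ->
  exists2 x : Pi n d, balanced x & Z x = y.
Proof.
have [b [w ->]] := Pi_labelled y => /pointed_divisible_labelled_dvd.
exact: labelled_Z_balanced.
Qed.

(** Minimal elements are handled by lifting to a balanced partition, refining it to [n %/ d] nonzero
    blocks and zeroing again; for merges, divisibility of the block sizes suffices. *)
Lemma is_rank_pointed_divisible :
  is_rank (fun y : Pi n 1 => pointed_divisible d y)
          (fun y => n %/ d - nonzero_blocks y).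
Proof.
apply: is_rank_nonzero_blocks.
- move=> y /Z_surjective[x bx <-]; rewrite nonzero_blocks_Z.
  exact: leq_nonzero_blocks.
- move=> y [py miny]; have [x bx xy] := Z_surjective py.
  have [z [bz zx <-]] := balanced_ge d_gt0 bx; rewrite -(nonzero_blocks_Z z).
  by rewrite (miny (Z z)) // -?xy; [apply: Z_pointed_divisible | apply: Z_le].
move=> b w s t sb tb st s0 /pointed_divisible_labelled_dvd dvd.
apply: dvd_pointed_divisible => r; rewrite {1}/relabel [b ord0 == s]eq_sym.
rewrite (negbTE s0) => r0; rewrite fiber_relabel //.
have [rt|_] := eqVneq r t; last first.
  by have [_|_] := eqVneq r s; rewrite ?cards0 // dvd.
rewrite cardsU disjoint_fiber // cards0 subn0 dvdn_add ?dvd //.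
by rewrite -rt.
Qed.

End Zeroing.

Theorem proposition9p14 (n d : nat) (d_gt1 : (1 < d)%N) :
  [/\ forall x : Pi n d, balanced x -> pointed_divisible d (Z x),
      forall x y : Pi n d, balanced x -> balanced y ->
        (x <= y)%O -> (Z x <= Z y)%O,
      forall (s : 'S_n) (x : Pi n d), balanced x ->
        Z (Pi_act s x) = Pi_act s (Z x),
      forall y : Pi n 1, pointed_divisible d y ->
        exists2 x : Pi n d, balanced x & Z x = y
    & exists (rk : Pi n d -> nat) (rk' : Pi n 1 -> nat),
        [/\ is_rank (fun x : Pi n d => balanced x) rk,
            is_rank (fun y : Pi n 1 => pointed_divisible d y) rk'
          & forall x : Pi n d, balanced x -> rk' (Z x) = rk x]].
Proof.
have d_gt0 : 0 < d by apply: ltnW.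
split.
- exact: Z_pointed_divisible.
- by move=> x y _ _; apply: Z_le.
- by move=> s x _; apply: Z_act.
- exact: Z_surjective.
exists (fun x => n %/ d - nonzero_blocks x), (fun y => n %/ d - nonzero_blocks y).
split; [exact: is_rank_balanced | exact: is_rank_pointed_divisible |].
by move=> x _; rewrite nonzero_blocks_Z.
Qed.
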